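(* Let $n,k \ge 1$ be integers and let $p=1$ or $p=2$. Then for all $f \in \mathcal{M}^+(\mathbb{R}^+)$ $$\|\mathcal{C}^*_n f \|_p^p \leq \frac{n^p}{(n+k)^p}\, \frac{p(n+k-1)+1}{p(n-1)+1}\, \|\mathcal{C}^*_{n+k} f \|_p^p.$$ Moreover, the constant is optimal, i.e. it is the smallest constant for which this inequality holds for all $f \in \mathcal{M}^+(\mathbb{R}^+)$.
   Context: $\mathbb{R}^+=(0,\infty)$ with Lebesgue measure; $\mathcal{M}^+(\mathbb{R}^+)$ is the set of non-negative measurable functions on $\mathbb{R}^+$; $\|\cdot\|_p$ is the $L^p(\mathbb{R}^+)$ norm (possibly $+\infty$). For an integer $m\ge 1$ and $f\in\mathcal{M}^+(\mathbb{R}^+)$, the dual of the generalized Cesàro operator of order $m$ is $$\mathcal{C}_m^* f(x) = m \int_x^\infty \frac{f(t)}{t^m} (t-x)^{m-1}\,dt,\qquad x>0$$ (values in $[0,\infty]$). *)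

(* Defs.v *)
From mathcomp Require Import all_boot all_order all_algebra.
From mathcomp Require Import all_classical all_reals all_analysis.
From mathcomp Require Import measurable_realfun.

Set Implicit Arguments.
Unset Strict Implicit.
Unset Printing Implicit Defensive.
Import Order.TTheory GRing.Theory Num.Theory.
Import numFieldNormedType.Exports.

Local Open Scope classical_set_scope.
Local Open Scope ring_scope.

(* The reals with the sigma-algebra of Lebesgue-measurable (not merely Borel)
   sets; this is the measurable type on which completed_lebesgue_measure is
   defined, and as a type it is convertible to R. *)
Notation lebesgueR R := (caratheodory_type ((wlength (@idfun R))^*)%mu).

Definition Rplus (R : realType) : set (lebesgueR R) := `]0, +oo[ : set R.
Arguments Rplus : clear implicits.

(* A function on R^+ is represented by a function on R whose values outside
   ]0, +oo[ are never used. As usual for the cone M^+, the value +oo is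
   allowed, so that the cone is stable under the operators below. *)
Definition Mplus (R : realType) (f : lebesgueR R -> \bar R) : Prop :=
  measurable_fun (Rplus R) f /\ (forall x : R, 0 < x -> (0 <= f x)%E).

Definition cesaro_dual (R : realType) (m : nat) (f : lebesgueR R -> \bar R)
    (x : R) : \bar R :=
  (m%:R%:E *
   \int[completed_lebesgue_measure]_(t in (`]x, +oo[ : set R))
      (f t * (((t : R) ^+ m)^-1)%:E * (((t : R) - x) ^+ (m - 1))%:E))%E.

Definition LnormRplus (R : realType) (p : nat) (g : lebesgueR R -> \bar R) :
    \bar R :=
  ('N[completed_lebesgue_measure]_(p%:R%:E) [g \_ (Rplus R)])%E.

Definition cesaro_const (R : realType) (n k p : nat) : R :=
  n%:R ^+ p / (n + k)%:R ^+ p *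
  ((p%:R * ((n + k)%:R - 1) + 1) / (p%:R * (n%:R - 1) + 1)).

(* Main.v *)
(** Tonelli gives [||C_m^* f||_1 = ||f||_1], and
    [||C_m^* f||_2^2 = \int\int f(s) f(t) K_m(s,t) ds dt] with
    [K_m(s,t) = m^2 (st)^-m \int_0^(min(s,t)) ((s-x)(t-x))^(m-1) dx], so the case
    [p = 2] follows from the pointwise bound [K_n <= c K_(n+k)], that is, from the
    monotonicity of [(2m-1) m^-2 K_m(s,t)] in [m].  For [s <= t], substituting
    [u = s - x], [d = t - s] and [W(u) = u(u+d)], it becomes
    [(2m-1) W(s) \int_0^s W^(m-1) <= (2m+1) \int_0^s W^m]; both sides vanish at
    [s = 0], and three successive differentiations in [s] reduce it to
    [4 W <= (2s+d)^2].

    The pointwise bound is an equality at [s = t], so extremal sequences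
    concentrate at a point: for [f] the indicator function of [(1,b)], the ratio of
    the two sides tends to [1] as [b] tends to [1]. *)

Require Import Defs.
From mathcomp Require Import all_boot all_order all_algebra.
From mathcomp Require Import all_classical all_reals all_analysis.
From mathcomp Require Import measurable_realfun.
From mathcomp Require Import ring lra.

Set Implicit Arguments.
Unset Strict Implicit.
Unset Printing Implicit Defensive.
Import Order.TTheory GRing.Theory Num.Theory.
Import numFieldNormedType.Exports.

Local Open Scope classical_set_scope.
Local Open Scope ring_scope.

(** * Polynomial inequalities behind the monotonicity in [m] *)

Lemma ler_horner_deriv (R : realType) (p : {poly R}) (a b : R) :
  a <= b -> (forall x, a < x -> x < b -> 0 <= p^`().[x]) -> p.[a] <= p.[b].
Proof.
move=> ab p0.
apply: (@ger0_derive1_le_cc R (horner p) a b) => //.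
- by move=> x; rewrite in_itv/= -derivE => /andP[? ?]; exact: p0.
- by apply: continuous_subspaceT; exact: continuous_horner.
- by rewrite in_itv/= lexx.
- by rewrite in_itv/= lexx ab.
Qed.

Lemma horner_ge0_deriv (R : realType) (p : {poly R}) (s : R) :
  0 <= s -> p.[0] = 0 -> (forall x, 0 <= x -> 0 <= p^`().[x]) -> 0 <= p.[s].
Proof.
by move=> s0 p0 dp; rewrite -p0 ler_horner_deriv// => x x0 _; exact/dp/ltW.
Qed.

(** At [i = 0] the quotient is a division by [0], hence [0] by convention, which makes this the
    antiderivative vanishing at [0]. *)
Definition primitive_poly (R : realType) (p : {poly R}) : {poly R} :=
  \poly_(i < (size p).+1) (p`_i.-1 / i%:R).

Lemma deriv_primitive (R : realType) (p : {poly R}) : (primitive_poly p)^`() = p.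
Proof.
apply/polyP => i; rewrite coef_deriv coef_poly ltnS /=.
case: ltnP => [_|si]; last by rewrite mul0rn nth_default.
by rewrite -mulrnAr -[_ *+ i.+1]mulr_natr mulVf ?mulr1// pnatr_eq0.
Qed.

Lemma primitive0 (R : realType) (p : {poly R}) : (primitive_poly p).[0] = 0.
Proof. by rewrite horner_coef0 coef_poly /= invr0 mulr0. Qed.

(* In the notation of the header, [wpoly d] is [W] and [bpoly d j] is the
   antiderivative of [W^j] vanishing at [0]. *)
Definition wpoly (R : realType) (d : R) : {poly R} := 'X * ('X + d%:P).
Definition bpoly (R : realType) (d : R) j := primitive_poly (wpoly d ^+ j).

Lemma horner_wpoly (R : realType) (d x : R) : (wpoly d).[x] = x * (x + d).
Proof. by rewrite /wpoly !hornerE. Qed.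

Lemma deriv_wpoly (R : realType) (d : R) : (wpoly d)^`() = 'X *+ 2 + d%:P.
Proof.
by rewrite /wpoly derivM derivD derivX derivC addr0 mul1r mulr1 addrAC mulr2n.
Qed.

(* The next three lemmas are the three differentiations, in reverse order: the
   derivative of the difference of the two sides is nonnegative by the previous
   lemma. *)
Lemma bpoly_le (R : realType) (d s : R) j : 0 <= d -> 0 <= s ->
  (4 * j + 2)%:R * (bpoly d j).[s] <= (s *+ 2 + d) * (s * (s + d)) ^+ j.
Proof.
move=> d0 s0; rewrite -subr_ge0; case: j => [|j].
  (* For [j = 0] the right-hand side takes the value [d] at [0], so only its part [s *+ 2] is
     compared by differentiation; the remaining [d] is non-negative. *)
  pose p : {poly R} := 'X *+ 2 - bpoly d 0 *+ 2.
  have : 0 <= p.[s].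
    apply: horner_ge0_deriv => //.
      by rewrite /p hornerD hornerN !hornerMn primitive0 hornerX mul0rn subr0.
    move=> x _; rewrite /p derivB !derivMn derivX deriv_primitive expr0 subrr.
    by rewrite hornerC.
  rewrite /p hornerD hornerN !hornerMn hornerX mulr1; lra.
pose p := ('X *+ 2 + d%:P) * wpoly d ^+ j.+1 - (bpoly d j.+1) *+ (4 * j.+1 + 2).
suff : 0 <= p.[s].
  rewrite /p hornerD hornerN hornerMn hornerM hornerD hornerMn hornerX hornerC.
  by rewrite horner_exp horner_wpoly mulr_natl.
apply: horner_ge0_deriv => //.
  rewrite /p hornerD hornerN hornerMn primitive0 mul0rn subr0 hornerM horner_exp.
  by rewrite horner_wpoly mul0r expr0n mulr0.
move=> x x0.
(* Since [(2x + d)^2 = 4 W(x) + d^2], the factor [4 * j.+1 + 2] is the one for which the terms in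
   [W^(j+1)] cancel. *)
have -> : p^`().[x] = j.+1%:R * d ^+ 2 * (x * (x + d)) ^+ j.
  rewrite /p derivB derivMn deriv_primitive derivM derivD derivMn derivX derivC.
  rewrite deriv_exp/= deriv_wpoly addr0.
  rewrite !(horner_wpoly, horner_exp, hornerD, hornerN, hornerMn, hornerM, hornerC,
  hornerX).
  set w := (x * (x + d)) ^+ j; rewrite exprS -/w.
  by ring.
by rewrite !mulr_ge0// ?exprn_ge0// ?mulr_ge0// addr_ge0.
Qed.

Lemma bpoly_mul_le (R : realType) (d s : R) j : 0 <= d -> 0 <= s ->
  (2 * j + 1)%:R * ((s *+ 2 + d) * (bpoly d j).[s]) <=
  2%:R * (s * (s + d)) ^+ j.+1.
Proof.
move=> d0 s0; rewrite -subr_ge0.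
pose p := wpoly d ^+ j.+1 *+ 2 - (('X *+ 2 + d%:P) * bpoly d j) *+ (2 * j + 1).
suff : 0 <= p.[s].
  rewrite /p hornerD hornerN !hornerMn hornerM hornerD hornerMn hornerX hornerC.
  by rewrite horner_exp horner_wpoly !mulr_natl.
apply: horner_ge0_deriv => //.
  rewrite /p hornerD hornerN !hornerMn hornerM primitive0 horner_exp horner_wpoly.
  by rewrite mul0r expr0n !mulr0 !mul0rn subrr.
move=> x x0; have := bpoly_le j d0 x0; rewrite -subr_ge0; congr (0 <= _).
rewrite /p derivB !derivMn deriv_exp deriv_wpoly derivM derivD derivMn derivX
  derivC.
rewrite deriv_primitive addr0 /=.
rewrite !(horner_wpoly, horner_exp, hornerD, hornerN, hornerMn, hornerM, hornerC,
  hornerX).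
set w := (x * (x + d)) ^+ j.
by ring.
Qed.

Lemma bpolyS_ge (R : realType) (d s : R) j : 0 <= d -> 0 <= s ->
  (2 * j + 1)%:R * (s * (s + d) * (bpoly d j).[s]) <=
  (2 * j + 3)%:R * (bpoly d j.+1).[s].
Proof.
move=> d0 s0; rewrite -subr_ge0.
pose p := bpoly d j.+1 *+ (2 * j + 3) - (wpoly d * bpoly d j) *+ (2 * j + 1).
suff : 0 <= p.[s].
  rewrite /p hornerD hornerN !hornerMn hornerM.
  by rewrite horner_wpoly !mulr_natl.
apply: horner_ge0_deriv => //.
  rewrite /p hornerD hornerN !hornerMn hornerM !primitive0.
  by rewrite mulr0 !mul0rn subrr.
move=> x x0; have := bpoly_mul_le j d0 x0; rewrite -subr_ge0; congr (0 <= _).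
rewrite /p derivB !derivMn derivM !deriv_primitive deriv_wpoly.
rewrite !(horner_wpoly, horner_exp, hornerD, hornerN, hornerMn, hornerM, hornerC,
  hornerX).
rewrite exprS; set w := (x * (x + d)) ^+ j.
by ring.
Qed.

(** * Integrals with respect to the completed Lebesgue measure *)

Lemma measurable_lebesgueR (R : realType) (A : set R) :
  measurable (A : set (measurableTypeR R)) -> measurable (A : set (lebesgueR R)).
Proof. exact: sub_caratheodory. Qed.

Lemma measurable_fun_lebesgueR d (T : measurableType d) (R : realType)
    (f : R -> T) (D : set R) :
  measurable (D : set (measurableTypeR R)) ->
  measurable_fun (D : set (measurableTypeR R)) f ->
  measurable_fun (D : set (lebesgueR R)) f.
Proof.
by move=> mD mf _ Y mY; apply: measurable_lebesgueR; apply: mf.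
Qed.

(** The identity, from Lebesgue-measurable to Borel sets, pushes the completed measure forward to
    [lebesgue_measure]. This makes the fundamental theorem of calculus available for Borel
    integrands. *)
Lemma ge0_integral_completed (R : realType) (D : set R) (f : R -> \bar R) :
  measurable (D : set (measurableTypeR R)) ->
  measurable_fun (D : set (measurableTypeR R)) f -> (forall x, D x -> (0 <= f x)%E) ->
  (\int[completed_lebesgue_measure]_(x in (D : set (lebesgueR R))) f x =
   \int[lebesgue_measure]_(x in D) f x)%E.
Proof.
move=> mD mf f0.
have mid : measurable_fun setT (idfun : lebesgueR R -> measurableTypeR R).
  by move=> _ Y mY; rewrite setTI; exact: measurable_lebesgueR.
rewrite -(@ge0_integral_pushforward _ _ _ _ _ _ mid completed_lebesgue_measure D f)//.
by move=> x; rewrite inE => /f0.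
Qed.

Lemma measurable_EFin_horner (R : realType) (p : {poly R}) (D : set R) :
  measurable_fun (D : set (measurableTypeR R)) (fun x : R => (p.[x])%:E).
Proof.
by apply: (measurableT_comp (@EFin_measurable R setT)); exact: measurable_poly.
Qed.

(** Every explicit integral below is computed by this lemma, from a polynomial antiderivative
    [P]. *)
Lemma ge0_integral_horner (R : realType) (P : {poly R}) (a b : R) :
  a <= b -> (forall x, a < x -> x < b -> 0 <= P^`().[x]) ->
  (\int[completed_lebesgue_measure]_(x in (`]a, b[ : set R)) (P^`().[x])%:E =
   (P.[b] - P.[a])%:E)%E.
Proof.
move=> ab P0; rewrite ge0_integral_completed//; last 2 first.
- exact: measurable_EFin_horner.
- by move=> x /=; rewrite in_itv/= lee_fin => /andP[? ?]; exact: P0.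
move: ab; rewrite le_eqVlt => /predU1P[->|ab].
  by rewrite subrr set_itv_ge ?bnd_simp ?ltxx// integral_set0.
have -> : (\int[lebesgue_measure]_(x in `]a, b[) (P^`().[x])%:E =
    \int[lebesgue_measure]_(x in `[a, b]) (P^`().[x])%:E)%E.
  rewrite [RHS]integral_itv_bndoo//.
  exact: measurable_EFin_horner.
apply: continuous_FTC2 => //.
- by apply: continuous_subspaceT; exact: continuous_horner.
- split.
  + by move=> x _; exact: derivable_horner.
  + by apply: cvg_at_right_filter; exact: continuous_horner.
  + by apply: cvg_at_left_filter; exact: continuous_horner.
- by move=> x _; rewrite derivE.
Qed.

(** * Integral operators with non-negative kernels *)

Section integral_operator.
Context d (T : measurableType d) (R : realType).
Variable mu : {sigma_finite_measure set T -> \bar R}.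
Local Open Scope ereal_scope.
Variable a : T -> T -> \bar R.
Hypothesis a0 : forall x t, 0 <= a x t.
Hypothesis ma : measurable_fun [set: T * T] (fun z => a z.1 z.2).
Variable f : T -> \bar R.
Hypothesis f0 : forall t, 0 <= f t.
Hypothesis mf : measurable_fun setT f.

Lemma measurable_kernel_row x : measurable_fun setT (a x).
Proof. exact: (measurableT_comp ma (pair1_measurable x)). Qed.

Lemma measurable_kernel_col t : measurable_fun setT (a ^~ t).
Proof. exact: (measurableT_comp ma (pair2_measurable t)). Qed.

Lemma integral_operator_ge0 x : 0 <= \int[mu]_t (f t * a x t).
Proof. by apply: integral_ge0 => t _; rewrite mule_ge0. Qed.

Lemma measurable_integral_operator :
  measurable_fun setT (fun x => \int[mu]_t (f t * a x t)).
Proof.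
apply: (measurable_fun_fubini_tonelli_F (fun z => f z.2 * a z.1 z.2)).
  by apply: emeasurable_funM => //; exact: measurableT_comp.
by move=> z; rewrite mule_ge0.
Qed.

(** Tonelli moves the operator from [f] to its transpose on the weight [w]. The weight [1] serves
    for [p = 1]; a column of the kernel and the image of [f] serve for [p = 2]. *)
Lemma integral_operator_tonelli (w : T -> \bar R) :
  (forall x, 0 <= w x) -> measurable_fun setT w ->
  \int[mu]_x ((\int[mu]_t (f t * a x t)) * w x) =
  \int[mu]_t (f t * \int[mu]_x (a x t * w x)).
Proof.
move=> w0 mw.
transitivity (\int[mu]_x \int[mu]_t (f t * a x t * w x)).
  apply: eq_integral => x _; rewrite ge0_integralZr//.
  - by apply: emeasurable_funM => //; exact: measurable_kernel_row.
  - by move=> t _; rewrite mule_ge0.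
rewrite (fubini_tonelli (fun z => f z.2 * a z.1 z.2 * w z.1)); last 2 first.
- apply: emeasurable_funM; last exact: measurableT_comp.
  by apply: emeasurable_funM => //; exact: measurableT_comp.
- by move=> z; rewrite !mule_ge0.
apply: eq_integral => t _ /=.
under eq_integral do rewrite -muleA.
rewrite ge0_integralZl//.
- by apply: emeasurable_funM => //; exact: measurable_kernel_col.
- by move=> x _; rewrite mule_ge0.
Qed.

Lemma measurable_integral_kernelM (w : T -> \bar R) :
  (forall x, 0 <= w x) -> measurable_fun setT w ->
  measurable_fun setT (fun t => \int[mu]_x (a x t * w x)).
Proof.
move=> w0 mw.
apply: (@measurable_fun_fubini_tonelli_G _ _ T T R mu (fun z => a z.1 z.2 * w z.1)).
  by apply: emeasurable_funM => //; exact: measurableT_comp.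
by move=> z; rewrite mule_ge0.
Qed.

(** The Gram kernel [\int a x s * a x t dx] acts as the operator followed by its transpose.
    Measurability in [t] is read off from this second form. *)
Lemma integral_operator_gram t :
  \int[mu]_s (f s * \int[mu]_x (a x s * a x t)) =
  \int[mu]_x (a x t * \int[mu]_s (f s * a x s)).
Proof.
rewrite -integral_operator_tonelli//; last exact: measurable_kernel_col.
by apply: eq_integral => x _; rewrite muleC.
Qed.

Lemma measurable_integral_operator_gram :
  measurable_fun setT
    (fun t => \int[mu]_s (f s * \int[mu]_x (a x s * a x t))).
Proof.
under eq_fun do rewrite integral_operator_gram.
apply: measurable_integral_kernelM; first exact: integral_operator_ge0.
exact: measurable_integral_operator.
Qed.

Lemma integral_operator_sqr :
  \int[mu]_x (\int[mu]_t (f t * a x t)) ^+ 2 =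
  \int[mu]_t (f t * \int[mu]_s (f s * \int[mu]_x (a x s * a x t))).
Proof.
under eq_integral do rewrite expe2.
(* One of the two factors of the square is taken as the weight. *)
rewrite integral_operator_tonelli; last 2 first.
- exact: integral_operator_ge0.
- exact: measurable_integral_operator.
by apply: eq_integral => t _; rewrite integral_operator_gram.
Qed.

End integral_operator.

(** Both sides are double integrals of [f s * f t] against Gram kernels. As [f] is non-negative, a
    pointwise comparison of these kernels can be integrated in [s] and then in [t]. *)
Lemma integral_operator_sqr_le d (T : measurableType d) (R : realType)
    (mu : {sigma_finite_measure set T -> \bar R}) (a b : T -> T -> \bar R)
    (f : T -> \bar R) (c : R) :
  (forall x t, 0 <= a x t)%E -> (forall x t, 0 <= b x t)%E ->
  measurable_fun [set: T * T] (fun z => a z.1 z.2) ->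
  measurable_fun [set: T * T] (fun z => b z.1 z.2) ->
  (forall t, 0 <= f t)%E -> measurable_fun setT f -> 0 <= c ->
  (forall s t, \int[mu]_x (a x s * a x t) <=
               c%:E * \int[mu]_x (b x s * b x t))%E ->
  (\int[mu]_x (\int[mu]_t (f t * a x t)) ^+ 2 <=
   c%:E * \int[mu]_x (\int[mu]_t (f t * b x t)) ^+ 2)%E.
Proof.
move=> a0 b0 ma mb f0 mf c0 ab.
rewrite !integral_operator_sqr//.
have K0 (k : T -> T -> \bar R) s t : (forall x u, 0 <= k x u)%E ->
    (0 <= \int[mu]_x (k x s * k x t))%E.
  by move=> k0; apply: integral_ge0 => x _; rewrite mule_ge0.
have G0 (k : T -> T -> \bar R) t : (forall x u, 0 <= k x u)%E ->
    (0 <= \int[mu]_s (f s * \int[mu]_x (k x s * k x t)))%E.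
  by move=> k0; apply: integral_ge0 => s _; rewrite mule_ge0// K0.
have mK (k : T -> T -> \bar R) t : (forall x u, 0 <= k x u)%E ->
    measurable_fun [set: T * T] (fun z => k z.1 z.2) ->
    measurable_fun setT (fun s => f s * \int[mu]_x (k x s * k x t))%E.
  move=> k0 mk; apply: emeasurable_funM => //.
  by apply: measurable_integral_kernelM => //; exact: measurable_kernel_col.
have mG (k : T -> T -> \bar R) : (forall x u, 0 <= k x u)%E ->
    measurable_fun [set: T * T] (fun z => k z.1 z.2) ->
    measurable_fun setT
      (fun t => f t * \int[mu]_s (f s * \int[mu]_x (k x s * k x t)))%E.
  move=> k0 mk; apply: emeasurable_funM => //.
  exact: measurable_integral_operator_gram.
rewrite -ge0_integralZl_EFin//; [|by move=> t _; rewrite mule_ge0// G0|exact: mG].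
apply: ge0_le_integral => //.
- by move=> t _; rewrite mule_ge0// G0.
- exact: mG.
- by apply: measurable_funeM; exact: mG.
move=> t _; rewrite muleCA lee_wpmul2l//.
rewrite -ge0_integralZl_EFin//; [|by move=> s _; rewrite mule_ge0// K0|exact: mK].
apply: ge0_le_integral => //.
- by move=> s _; rewrite mule_ge0// K0.
- exact: mK.
- by apply: measurable_funeM; exact: mK.
by move=> s _; rewrite muleCA lee_wpmul2l.
Qed.

(** * The kernel of [C_m^*] and the comparison of its Gram kernels *)

(** Divided by [W(s)^(i+2)], [bpolyS_ge] says that the sequence with terms
    [(2i + 1) B_i(s) / W(s)^(i+1)], where [B_i] is [bpoly d i], does not decrease from [i] to
    [i + 1]; induction on [k] chains these steps. *)
Lemma bpoly_ratio_le (R : realType) (d s : R) (j k : nat) : 0 <= d -> 0 < s ->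
  (2 * j + 1)%:R * ((bpoly d j).[s] / (s * (s + d)) ^+ j.+1) <=
  (2 * (j + k) + 1)%:R * ((bpoly d (j + k)).[s] / (s * (s + d)) ^+ (j + k).+1).
Proof.
move=> d0 s0.
have w0 : 0 < s * (s + d) by rewrite mulr_gt0// ltr_wpDr.
elim: k => [|k IH]; first by rewrite addn0.
rewrite (le_trans IH)// (addnS j k); set i := (j + k)%N.
rewrite (exprS _ i.+1) invfM !mulrA.
rewrite ler_pM2r ?invr_gt0 ?exprn_gt0// ler_pdivlMr//.
have := bpolyS_ge i d0 (ltW s0).
have -> : (2 * i.+1 + 1 = 2 * i + 3)%N by rewrite mulnS addnC addnA addnC.
by rewrite -[X in _ -> X <= _]mulrA [X in _ -> _ * X <= _]mulrC.
Qed.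

(** Extending the kernel by [0] lets every integral run over the whole line, as the Tonelli lemmas
    above require. *)
Definition cesaro_kernel (R : realType) (m : nat) (x t : R) : R :=
  if (0 < x) && (x < t) then m%:R * (t ^+ m)^-1 * (t - x) ^+ (m - 1) else 0.

Lemma cesaro_kernel_ge0 (R : realType) m (x t : R) : 0 <= cesaro_kernel m x t.
Proof.
rewrite /cesaro_kernel; case: ifPn => // /andP[x0 xt].
have t0 : 0 < t by exact: lt_trans xt.
by rewrite !mulr_ge0 ?invr_ge0 ?exprn_ge0 ?subr_ge0// ltW.
Qed.

Lemma measurable_cesaro_kernel (R : realType) m :
  measurable_fun [set: lebesgueR R * lebesgueR R]
    (fun z => (cesaro_kernel m (z.1 : R) (z.2 : R))%:E).
Proof.
have mid : measurable_fun setT (idfun : lebesgueR R -> R).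
  by move=> _ Y mY; rewrite setTI; exact: measurable_lebesgueR.
have m1 : measurable_fun [set: lebesgueR R * lebesgueR R] (fun z => z.1 : R).
  exact: (measurableT_comp mid measurable_fst).
have m2 : measurable_fun [set: lebesgueR R * lebesgueR R] (fun z => z.2 : R).
  exact: (measurableT_comp mid measurable_snd).
apply: (measurableT_comp (@EFin_measurable R setT)).
(* On the support of the kernel [t > 0], and there the inverse is [powR _ (-1)],
   which is known to be measurable. *)
rewrite [X in measurable_fun _ X](_ : _ = fun z : lebesgueR R * lebesgueR R =>
  if ((0 : R) < z.1) && ((z.1 : R) < z.2) then
    m%:R * ((z.2 : R) ^+ m) `^ (-1) * ((z.2 : R) - z.1) ^+ (m - 1) else 0); last first.
  apply/funext => z; rewrite /cesaro_kernel; case: ifPn => // /andP[x0 xt].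
  by rewrite powR_inv1// exprn_ge0// ltW// (lt_trans x0).
apply: measurable_fun_ifT => //.
- by apply: measurable_and; apply: measurable_fun_ltr.
- apply: measurable_funM; last exact/measurable_funX/measurable_funB.
  apply: measurable_funM => //.
  apply: (measurableT_comp (measurable_powR _)). exact: measurable_funX.
Qed.

Lemma measurable_Rplus (R : realType) : measurable (Rplus R).
Proof. by apply: measurable_lebesgueR; exact: measurable_itv. Qed.

(** An antiderivative in [x] is [- (t - x)^m / t^m]. This normalisation is why [C_m^*] preserves the
    [L^1] norm. *)
Lemma integral_cesaro_kernel (R : realType) m (t : R) : (0 < m)%N -> 0 < t ->
  (\int[completed_lebesgue_measure]_x
     (cesaro_kernel m (x : R) t)%:E = 1)%E.
Proof.
move=> m0 t0; pose P : {poly R} := (- (t ^+ m)^-1) *: (t%:P - 'X) ^+ m.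
have dP x : P^`().[x] = m%:R * (t ^+ m)^-1 * (t - x) ^+ (m - 1).
  rewrite /P derivZ deriv_exp derivB derivC derivX sub0r !hornerE hornerMn.
  by rewrite !hornerE -subn1; ring.
have tm0 : t ^+ m != 0 by rewrite expf_neq0 // gt_eqF.
have -> : (1 = (P.[t] - P.[0])%:E :> \bar R)%E.
  rewrite /P !hornerE subrr subr0 expr0n gtn_eqF// mulr0.
  by rewrite sub0r mulNr opprK mulVf.
rewrite -ge0_integral_horner; [|exact: ltW|]; last first.
  move=> x x0 xt; rewrite dP.
  by rewrite !mulr_ge0 ?invr_ge0 ?exprn_ge0 ?subr_ge0// ltW.
rewrite [RHS]integral_mkcond; apply: eq_integral => x _.
rewrite patchE; case: ifPn => [|/negP]; rewrite inE/= in_itv/= => xt.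
  by rewrite dP /cesaro_kernel xt.
by rewrite /cesaro_kernel ifN//; exact/negP.
Qed.

(** The product of the kernels lives on []0, s[], where [u = s - x] and [d = t - s] turn
    [(s - x) * (t - x)] into [W(u)]. The antiderivative is therefore [bpoly] composed with [s - x],
    the reversal of orientation giving the minus sign. *)
Lemma integral_cesaro_kernelM (R : realType) m (s t : R) : (0 < m)%N ->
  0 < s -> s <= t ->
  (\int[completed_lebesgue_measure]_x
     ((cesaro_kernel m (x : R) s)%:E * (cesaro_kernel m (x : R) t)%:E) =
   (m%:R ^+ 2 * ((bpoly (t - s) m.-1).[s] / (s * t) ^+ m))%:E)%E.
Proof.
move=> m0 s0 st; have t0 : 0 < t by exact: lt_le_trans st.
pose P : {poly R} := (- (m%:R ^+ 2 / (s * t) ^+ m)) *: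
  (bpoly (t - s) m.-1 \Po (s%:P - 'X)).
have sX x : (s%:P - 'X : {poly R}).[x] = s - x by rewrite !hornerE.
have dP x : P^`().[x] = m%:R * (s ^+ m)^-1 * (s - x) ^+ (m - 1) *
                        (m%:R * (t ^+ m)^-1 * (t - x) ^+ (m - 1)).
  rewrite /P derivZ deriv_comp derivB derivC derivX sub0r.
  have tx : s - x + (t - s) = t - x by ring.
  rewrite deriv_primitive hornerZ hornerM horner_comp sX horner_exp horner_wpoly.
  by rewrite tx hornerN hornerC !exprMn invfM subn1; ring.
have -> : m%:R ^+ 2 * ((bpoly (t - s) m.-1).[s] / (s * t) ^+ m) = P.[s] - P.[0].
  rewrite /P !hornerZ !horner_comp !sX subrr subr0 primitive0.
  by ring.
rewrite -ge0_integral_horner; [|exact: ltW|]; last first.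
  move=> x x0 xs; rewrite dP; have xt := lt_le_trans xs st.
  by rewrite !mulr_ge0 ?invr_ge0 ?exprn_ge0 ?subr_ge0// ltW.
rewrite [RHS]integral_mkcond; apply: eq_integral => x _.
rewrite patchE; case: ifPn => [|/negP]; rewrite inE/= in_itv/= => xs.
  have /andP[x0 xs'] := xs.
  by rewrite dP /cesaro_kernel xs x0 (lt_le_trans xs' st) EFinM.
by rewrite /cesaro_kernel ifN ?mul0e//; exact/negP.
Qed.

Lemma cesaro_const_gt0 (R : realType) n k p : (0 < n)%N ->
  0 < cesaro_const R n k p.
Proof.
move=> n0; have nk0 : (0 < n + k)%N by rewrite ltn_addr.
have P m : (0 < m)%N -> 0 < p%:R * (m%:R - 1) + 1 :> R.
  by move=> m0; rewrite ltr_wpDl// mulr_ge0// subr_ge0 ler1n.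
by rewrite /cesaro_const; apply: mulr_gt0; apply: divr_gt0; rewrite ?exprn_gt0 ?ltr0n ?P.
Qed.

(** The constant is the quotient of the values of [m^2 / (2m - 1)] at [n] and at [n + k]. By
    symmetry [s <= t], and with [d = t - s] one has [W(s) = s * t], so that [bpoly_ratio_le] is the
    required bound. *)
Lemma integral_cesaro_kernelM_le (R : realType) (n k : nat) (s t : R) :
  (0 < n)%N ->
  (\int[completed_lebesgue_measure]_x
     ((cesaro_kernel n x s)%:E * (cesaro_kernel n x t)%:E) <=
   (cesaro_const R n k 2)%:E * \int[completed_lebesgue_measure]_x
     ((cesaro_kernel (n + k) x s)%:E * (cesaro_kernel (n + k) x t)%:E))%E.
Proof.
move=> n0; wlog st : s t / s <= t.
  move=> H; have [/H//|/ltW/H] := leP s t.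
  by congr (_ <= _ * _)%E; apply: eq_integral => x _; rewrite muleC.
(* For [s <= 0] no [x] satisfies [0 < x < s], and both integrals are [0]. *)
have [s0|s0] := leP s 0.
  have K0 m x : cesaro_kernel m x s = 0.
    by rewrite /cesaro_kernel; case: andP => // -[x0 /(lt_trans x0)]; rewrite ltNge s0.
  by rewrite !integral0_eq ?mule0// => x _; rewrite K0 mul0e.
have nk0 : (0 < n + k)%N by rewrite ltn_addr.
rewrite !integral_cesaro_kernelM// -EFinM lee_fin.
(* [K_m] contains the power [m - 1] of [W], whence the index [n.-1]; the factor [2 * j + 1] then
   becomes [2m - 1]. *)
have := @bpoly_ratio_le R (t - s) s n.-1 k.
rewrite subrKC subr_ge0 => /(_ st s0).
have nkS : (n.-1 + k).+1 = (n + k)%N by rewrite -addSn prednK.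
have -> : (n + k).-1 = (n.-1 + k)%N by rewrite -nkS.
rewrite prednK// nkS.
set B := _ / _; set B' := _ / _ => BB'.
rewrite /cesaro_const.
have n1 : (n%:R : R) = n.-1%:R + 1 by rewrite natr1 prednK.
have -> : 2%:R * ((n + k)%:R - 1) + 1 = (2 * (n.-1 + k) + 1)%:R :> R.
  by rewrite !natrD n1; ring.
have -> : 2%:R * (n%:R - 1) + 1 = (2 * n.-1 + 1)%:R :> R by rewrite n1; ring.
set u := (2 * n.-1 + 1)%:R in BB' *; set v := (2 * (n.-1 + k) + 1)%:R in BB' *.
have u0 : 0 < u by rewrite ltr0n addn1.
have N0 : (n + k)%:R ^+ 2 != 0 :> R by rewrite expf_neq0// pnatr_eq0 -lt0n.
have -> : n%:R ^+ 2 / (n + k)%:R ^+ 2 * (v / u) * ((n + k)%:R ^+ 2 * B') =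
          n%:R ^+ 2 * (v * B' / u).
  by move: ((n + k)%:R ^+ 2) N0 => N N0; field; rewrite N0 gt_eqF.
by rewrite ler_wpM2l ?exprn_ge0// ler_pdivlMr// mulrC.
Qed.

(** * Norms of [C_m^* f] as integrals against the kernel *)

Lemma Mplus_patch_ge0 (R : realType) (f : lebesgueR R -> \bar R) :
  Mplus f -> forall t, (0 <= (f \_ (Rplus R)) t)%E.
Proof.
move=> [_ f0] t; apply: erestrict_ge0 => x.
by rewrite /Rplus/= in_itv/= andbT => /f0.
Qed.

Lemma measurable_Mplus_patch (R : realType) (f : lebesgueR R -> \bar R) :
  Mplus f -> measurable_fun setT (f \_ (Rplus R)).
Proof. by move=> [mf _]; exact: (measurable_restrictT _ (@measurable_Rplus R)).1. Qed.

Lemma measurable_EFin_cesaro_kernel (R : realType) m (x : lebesgueR R) :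
  measurable_fun [set: lebesgueR R] (fun t => (cesaro_kernel m x t)%:E).
Proof.
exact: (@measurable_kernel_row _ (lebesgueR R) R
  (fun x t : lebesgueR R => (cesaro_kernel m x t)%:E)
  (@measurable_cesaro_kernel R m)).
Qed.

Lemma cesaro_dual_patchE (R : realType) m (f : lebesgueR R -> \bar R) (x : R) :
  (0 < m)%N -> Mplus f ->
  (cesaro_dual m f \_ (Rplus R)) x =
  (\int[completed_lebesgue_measure]_t
     ((f \_ (Rplus R)) t * (cesaro_kernel m x t)%:E))%E.
Proof.
move=> m0 Mf; rewrite patchE; case: ifPn => [|/negP]; rewrite inE /Rplus/= in_itv/= andbT => x0.
  rewrite /cesaro_dual.
  (* The kernel already carries the factor [m], which is compensated by [m^-1] under the
     integral. *)
  transitivity (m%:R%:E * \int[completed_lebesgue_measure]_(t in (`]x, +oo[ : set R))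
      (m%:R^-1%:E * ((f \_ (Rplus R)) t * (cesaro_kernel m x t)%:E)))%E.
    congr (_ * _)%E; apply: eq_integral => t; rewrite inE/= in_itv/= andbT => xt.
    rewrite patchE mem_set; last by rewrite /Rplus/= in_itv/= (lt_trans x0).
    rewrite /cesaro_kernel x0 xt/= [RHS]muleCA -muleA; congr (_ * _)%E.
    by rewrite -!EFinM !mulrA mulVf ?mul1r// pnatr_eq0 -lt0n.
  rewrite ge0_integralZl_EFin; last 4 first.
  - by apply: measurable_lebesgueR; exact: measurable_itv.
  - by move=> t _; rewrite mule_ge0 ?lee_fin ?cesaro_kernel_ge0 ?Mplus_patch_ge0.
  - apply: measurable_funTS; apply: emeasurable_funM.
      exact: measurable_Mplus_patch.
    exact: measurable_EFin_cesaro_kernel.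
  - by rewrite invr_ge0.
  rewrite muleA -EFinM mulfV ?pnatr_eq0 -?lt0n// mul1e.
  rewrite integral_mkcond; apply: eq_integral => t _.
  rewrite [LHS]patchE; case: ifPn => // /negP; rewrite inE/= in_itv/= andbT => xt.
  by rewrite /cesaro_kernel [X in if _ && X then _ else _](negbTE _) ?andbF ?mule0//; exact/negP.
(* For [x <= 0] the kernel vanishes, in agreement with the extension of [C_m^* f] by [0]. *)
rewrite integral0_eq// => t _.
by rewrite /cesaro_kernel [X in if X && _ then _ else _](negbTE _) ?mule0//; exact/negP.
Qed.

Lemma poweR_natE (R : realType) (x : \bar R) (n : nat) :
  (0 < n)%N -> (0 <= x)%E -> (x `^ n%:R = x ^+ n)%E.
Proof.
move=> n0; case: x => [r r0|_|//].
  by rewrite poweR_EFin powR_mulrn// EFin_expe.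
rewrite poweRyr ?pnatr_eq0 -?lt0n//.
by case: n n0 => // n _; elim: n => [//|n IH]; rewrite expeS -IH mulyy.
Qed.

Lemma LnormRplus_exp (R : realType) (p : nat) (g : lebesgueR R -> \bar R) :
  (0 < p)%N -> (forall x, 0 <= (g \_ (Rplus R)) x)%E ->
  (LnormRplus p g ^+ p =
   \int[completed_lebesgue_measure]_x ((g \_ (Rplus R)) x) ^+ p)%E.
Proof.
move=> p0 g0; rewrite /LnormRplus -poweR_natE ?Lnorm_ge0//.
rewrite powR_Lnorm ?pnatr_eq0 -?lt0n//.
by apply: eq_integral => x _; rewrite gee0_abs ?poweR_natE.
Qed.

Lemma LnormRplus_cesaro_dual (R : realType) (p m : nat)
    (f : lebesgueR R -> \bar R) : (0 < p)%N -> (0 < m)%N -> Mplus f ->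
  (LnormRplus p (cesaro_dual m f) ^+ p =
   \int[completed_lebesgue_measure]_x (\int[completed_lebesgue_measure]_t
     ((f \_ (Rplus R)) t * (cesaro_kernel m x t)%:E)) ^+ p)%E.
Proof.
move=> p0 m0 Mf; rewrite LnormRplus_exp//.
  by apply: eq_integral => x _; rewrite cesaro_dual_patchE.
move=> x; rewrite cesaro_dual_patchE// integral_ge0// => t _.
by rewrite mule_ge0 ?Mplus_patch_ge0// lee_fin cesaro_kernel_ge0.
Qed.

Lemma LnormRplus1_cesaro_dual (R : realType) (m : nat)
    (f : lebesgueR R -> \bar R) : (0 < m)%N -> Mplus f ->
  (LnormRplus 1 (cesaro_dual m f) ^+ 1 =
   \int[completed_lebesgue_measure]_t (f \_ (Rplus R)) t)%E.
Proof.
move=> m0 Mf; rewrite LnormRplus_cesaro_dual//.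
(* The weight [1] is inserted so that the Tonelli identity applies. *)
transitivity (\int[completed_lebesgue_measure]_x
  ((\int[completed_lebesgue_measure]_t
     ((f \_ (Rplus R)) t * (cesaro_kernel m x t)%:E)) * 1))%E.
  by apply: eq_integral => x _; rewrite mule1.
rewrite (@integral_operator_tonelli _ _ _ completed_lebesgue_measure
  (fun x t : lebesgueR R => (cesaro_kernel m x t)%:E))//.
- apply: eq_integral => t _; under eq_integral do rewrite mule1.
  (* A column of index [t <= 0] does not have integral [1], but the extension of [f] vanishes
     there. *)
  rewrite patchE; case: ifPn => [|_]; last by rewrite mul0e.
  rewrite inE /Rplus/= in_itv/= andbT => t0.
  by rewrite integral_cesaro_kernel// mule1.
- by move=> x t; rewrite lee_fin cesaro_kernel_ge0.
- exact: measurable_cesaro_kernel.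
- exact: Mplus_patch_ge0.
- exact: measurable_Mplus_patch.
Qed.

Lemma LnormRplus2_cesaro_dual_le (R : realType) (n k : nat)
    (f : lebesgueR R -> \bar R) : (0 < n)%N -> Mplus f ->
  (LnormRplus 2 (cesaro_dual n f) ^+ 2 <=
   (cesaro_const R n k 2)%:E * LnormRplus 2 (cesaro_dual (n + k) f) ^+ 2)%E.
Proof.
move=> n0 Mf; have nk0 : (0 < n + k)%N by rewrite ltn_addr.
rewrite !LnormRplus_cesaro_dual//.
have K0 m (x t : lebesgueR R) : (0 <= (cesaro_kernel m x t)%:E)%E.
  by rewrite lee_fin cesaro_kernel_ge0.
apply: (@integral_operator_sqr_le _ _ _ completed_lebesgue_measure
  (fun x t : lebesgueR R => (cesaro_kernel n x t)%:E)
  (fun x t : lebesgueR R => (cesaro_kernel (n + k) x t)%:E)).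
- exact: K0.
- exact: K0.
- exact: measurable_cesaro_kernel.
- exact: measurable_cesaro_kernel.
- exact: Mplus_patch_ge0.
- exact: measurable_Mplus_patch.
- exact/ltW/cesaro_const_gt0.
- by move=> s t; exact: integral_cesaro_kernelM_le.
Qed.

Lemma cesaro_const1 (R : realType) n k : (0 < n)%N -> cesaro_const R n k 1 = 1.
Proof.
move=> n0; have nk0 : (0 < n + k)%N by rewrite ltn_addr.
rewrite /cesaro_const !expr1 !mul1r !subrK.
by rewrite mulrA mulfVK ?mulfV// pnatr_eq0 -lt0n.
Qed.

(** * Optimality, tested on the indicator functions of [(1,b)] *)

Lemma measurable_fun_expe d (T : measurableType d) (R : realType) (D : set T)
    (g : T -> \bar R) n :
  measurable_fun D g -> measurable_fun D (fun x => g x ^+ n)%E.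
Proof.
move=> mg; elim: n => [|n IH]; first exact: measurable_cst.
by under eq_fun do rewrite expeS; exact: emeasurable_funM.
Qed.

Lemma integral_cst_oo (R : realType) (a b c : R) : a <= b -> 0 <= c ->
  (\int[completed_lebesgue_measure]_(x in (`]a, b[ : set R)) c%:E =
   (c * (b - a))%:E)%E.
Proof.
move=> ab c0; pose P : {poly R} := c *: 'X.
have dP x : P^`().[x] = c by rewrite /P derivZ derivX hornerZ hornerC mulr1.
have -> : c * (b - a) = P.[b] - P.[a] by rewrite /P !hornerE mulrBr.
rewrite -ge0_integral_horner//; last by move=> x _ _; rewrite dP.
by apply: eq_integral => x _; rewrite dP.
Qed.

Lemma integral_exp_oo (R : realType) (A b : R) N : 0 <= A -> 0 <= b ->
  (\int[completed_lebesgue_measure]_(x in (`]0%R, b[ : set R))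
     (A * (b - x) ^+ N)%:E = (A * b ^+ N.+1 / N.+1%:R)%:E)%E.
Proof.
move=> A0 b0; pose P : {poly R} := (- (A / N.+1%:R)) *: (b%:P - 'X) ^+ N.+1.
have bX x : (b%:P - 'X : {poly R}).[x] = b - x by rewrite !hornerE.
have N0 : N.+1%:R != 0 :> R by rewrite pnatr_eq0.
have dP x : P^`().[x] = A * (b - x) ^+ N.
  rewrite /P derivZ deriv_exp derivB derivC derivX sub0r /=.
  rewrite hornerZ hornerMn hornerM horner_exp bX hornerN hornerC.
  rewrite -[(_ * _) *+ _]mulr_natr; move: (N.+1%:R) N0 => M M0.
  by field; exact: M0.
have -> : A * b ^+ N.+1 / N.+1%:R = P.[b] - P.[0].
  rewrite /P !hornerZ !horner_exp !bX subrr subr0 expr0n mulr0 sub0r mulNr opprK.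
  by rewrite mulrAC.
rewrite -ge0_integral_horner//; last first.
  by move=> x _ xb; rewrite dP mulr_ge0// exprn_ge0// subr_ge0 ltW.
by apply: eq_integral => x _; rewrite dP.
Qed.

Lemma Mplus_indic_oo (R : realType) (b : R) :
  Mplus (cst 1%E \_ (`]1%R, b[ : set R) : lebesgueR R -> \bar R).
Proof.
split; last by move=> x _; rewrite patchE; case: ifP.
have mI : measurable (`]1%R, b[%classic : set (lebesgueR R)).
  by apply: measurable_lebesgueR; exact: measurable_itv.
have m1 : measurable_fun (`]1%R, b[%classic : set (lebesgueR R)) (cst 1%E : _ -> \bar R).
  exact: measurable_cst.
have := (measurable_restrictT _ mI).1 m1.
exact: measurable_funTS.
Qed.

(* [C_m^* f] for [f] the indicator function of [(1,b)], extended by [0] to the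
   non-positive reals. *)
Definition indic_oo_op (R : realType) (b : R) m (x : R) : \bar R :=
  (\int[completed_lebesgue_measure]_t
     (((cst 1%E \_ (`]1%R, b[ : set R) : lebesgueR R -> \bar R) \_ (Rplus R)) t *
      (cesaro_kernel m x t)%:E))%E.

Lemma indic_oo_opE (R : realType) (b : R) m (x : R) :
  (indic_oo_op b m x = \int[completed_lebesgue_measure]_(t in (`]1%R, b[ : set R))
      (cesaro_kernel m x t)%:E)%E.
Proof.
rewrite /indic_oo_op [RHS]integral_mkcond; apply: eq_integral => t _.
rewrite !patchE; case: (boolP (t \in `]1%R, b[%classic)) => tb; last first.
  by case: ifP; rewrite mul0e.
rewrite ifT ?mul1e//; move: tb; rewrite !inE /Rplus/= !in_itv/= andbT.
by move=> /andP[+ _]; exact: lt_trans.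
Qed.

Lemma measurable_indic_oo_op (R : realType) (b : R) m :
  measurable_fun [set: lebesgueR R] (indic_oo_op b m).
Proof.
apply: (@measurable_integral_operator _ _ _ completed_lebesgue_measure
  (fun x t : lebesgueR R => (cesaro_kernel m x t)%:E)).
- by move=> x t; rewrite lee_fin cesaro_kernel_ge0.
- exact: measurable_cesaro_kernel.
- exact: Mplus_patch_ge0 (Mplus_indic_oo b).
- exact: measurable_Mplus_patch (Mplus_indic_oo b).
Qed.

Lemma indic_oo_op_ge0 (R : realType) (b : R) m x : (0 <= indic_oo_op b m x)%E.
Proof.
rewrite indic_oo_opE; apply: integral_ge0 => t _.
by rewrite lee_fin cesaro_kernel_ge0.
Qed.

(** For [t] in []1, b[], [t^m <= b^m] and [t - x >= 1 - x]; the factor [b - 1] is the length of the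
    interval. *)
Lemma indic_oo_op_ge (R : realType) (b : R) m (x : R) : 1 < b -> 0 < x -> x < 1 ->
  (((b - 1) * m%:R / b ^+ m * (1 - x) ^+ (m - 1))%:E <= indic_oo_op b m x)%E.
Proof.
move=> b1 x0 x1; have b0 : 0 < b by exact: lt_trans b1.
have x10 : 0 <= 1 - x by rewrite subr_ge0 ltW.
have -> : (b - 1) * m%:R / b ^+ m * (1 - x) ^+ (m - 1) =
    m%:R / b ^+ m * (1 - x) ^+ (m - 1) * (b - 1) by ring.
have c0 : 0 <= m%:R / b ^+ m * (1 - x) ^+ (m - 1).
  by rewrite !mulr_ge0 ?invr_ge0 ?exprn_ge0// ltW.
rewrite indic_oo_opE -(integral_cst_oo (ltW b1) c0).
apply: ge0_le_integral.
- by apply: measurable_lebesgueR; exact: measurable_itv.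
- by move=> t _; rewrite lee_fin.
- exact: measurable_cst.
- by apply: measurable_funTS; exact: measurable_EFin_cesaro_kernel.
move=> t /=; rewrite in_itv/= => /andP[t1 tb]; have t0 : 0 < t by exact: lt_trans t1.
rewrite /cesaro_kernel x0 (lt_trans x1 t1)/= lee_fin ler_pM ?exprn_ge0//.
- by rewrite mulr_ge0 ?invr_ge0 ?exprn_ge0// ltW.
- by rewrite ler_wpM2l// lef_pV2 ?posrE ?exprn_gt0// lerXn2r ?nnegrE ?ltW.
- have tx : 1 - x <= t - x by rewrite lerD2r ltW.
  by rewrite lerXn2r ?nnegrE// (le_trans x10).
Qed.

(** Here [t^m >= 1] and [t - x <= b - x]; when [t <= x] the kernel is [0] and the bound is
    trivial. *)
Lemma indic_oo_op_le (R : realType) (b : R) m (x : R) : 1 < b -> 0 < x -> x < b ->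
  (indic_oo_op b m x <= ((b - 1) * m%:R * (b - x) ^+ (m - 1))%:E)%E.
Proof.
move=> b1 x0 xb; have xb0 : 0 <= b - x by rewrite subr_ge0 ltW.
have -> : (b - 1) * m%:R * (b - x) ^+ (m - 1) =
    m%:R * (b - x) ^+ (m - 1) * (b - 1) by ring.
have c0 : 0 <= m%:R * (b - x) ^+ (m - 1) by rewrite mulr_ge0 ?exprn_ge0.
rewrite indic_oo_opE -(integral_cst_oo (ltW b1) c0).
apply: ge0_le_integral.
- by apply: measurable_lebesgueR; exact: measurable_itv.
- by move=> t _; rewrite lee_fin cesaro_kernel_ge0.
- by apply: measurable_funTS; exact: measurable_EFin_cesaro_kernel.
- exact: measurable_cst.
move=> t /=; rewrite in_itv/= => /andP[t1 tb]; have t0 : 0 < t by exact: lt_trans t1.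
rewrite lee_fin /cesaro_kernel; case: ifPn => // /andP[_ xt].
rewrite ler_pM ?exprn_ge0 ?subr_ge0 ?(ltW xt)//.
- by rewrite mulr_ge0 ?invr_ge0 ?exprn_ge0// ltW.
- by rewrite ler_piMr// invf_le1 ?exprn_gt0// exprn_ege1// ltW.
- have tx : t - x <= b - x by rewrite lerD2r ltW.
  by rewrite lerXn2r ?nnegrE ?subr_ge0 ?(ltW xt) ?(ltW xb).
Qed.

Lemma indic_oo_op_eq0 (R : realType) (b : R) m (x : R) : ~~ ((0 < x) && (x < b)) ->
  indic_oo_op b m x = 0%E.
Proof.
move=> xb; rewrite indic_oo_opE integral0_eq// => t /=; rewrite in_itv/= => /andP[_ tb].
rewrite /cesaro_kernel; case: ifPn => // /andP[x0 xt].
by move: xb; rewrite x0 (lt_trans xt tb).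
Qed.

Lemma lee_expe (R : realType) (x y : \bar R) n :
  (0 <= x -> x <= y -> x ^+ n <= y ^+ n)%E.
Proof.
move=> x0 xy; elim: n => [//|n IH].
by rewrite !expeS lee_pmul// expe_ge0.
Qed.

Lemma measurable_EFin_expB (R : realType) (A b : R) N (D : set R) :
  measurable (D : set (measurableTypeR R)) ->
  measurable_fun (D : set (lebesgueR R)) (fun x : R => (A * (b - x) ^+ N)%:E).
Proof.
move=> mD; apply: measurable_fun_lebesgueR => //.
apply: (@eq_measurable_fun _ _ (measurableTypeR R) _ _
    (fun x : R => (A *: (b%:P - 'X) ^+ N : {poly R}).[x]%:E)).
  by move=> x _; rewrite hornerZ horner_exp hornerD hornerN hornerX hornerC.
exact: measurable_EFin_horner.
Qed.

(** The integral is restricted to []0, 1[]. The denominator [p * (m - 1) + 1], which is the one in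
    [cesaro_const], comes from integrating [(1 - x)^(p * (m - 1))]. *)
Lemma integral_indic_oo_op_ge (R : realType) (b : R) m p : 1 < b ->
  ((((b - 1) * m%:R / b ^+ m) ^+ p / (p * (m - 1)).+1%:R)%:E <=
   \int[completed_lebesgue_measure]_x (indic_oo_op b m x ^+ p))%E.
Proof.
move=> b1; have b0 : 0 < b by exact: lt_trans b1.
have A0 : 0 <= (b - 1) * m%:R / b ^+ m.
  by rewrite !mulr_ge0 ?invr_ge0 ?exprn_ge0 ?subr_ge0// ltW.
have I := @integral_exp_oo R _ 1 (p * (m - 1)) (exprn_ge0 p A0) ler01.
rewrite expr1n mulr1 in I; rewrite -I.
have m01 : measurable (`]0%R, 1%R[%classic : set (lebesgueR R)).
  by apply: measurable_lebesgueR; exact: measurable_itv.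
have mo := measurable_fun_expe p (@measurable_indic_oo_op R b m).
apply: (@le_trans _ _ (\int[completed_lebesgue_measure]_(x in (`]0%R, 1%R[ : set R))
    (indic_oo_op b m x ^+ p))%E); last first.
  apply: ge0_subset_integral; [exact: m01|exact: measurableT|exact: mo| |].
  - by move=> x _; rewrite expe_ge0// indic_oo_op_ge0.
  - exact: subsetT.
apply: ge0_le_integral; [exact: m01| | | |].
- move=> x /=; rewrite in_itv/= => /andP[x0 x1].
  by rewrite lee_fin mulr_ge0 ?exprn_ge0// subr_ge0 ltW.
- by apply: measurable_EFin_expB; exact: measurable_itv.
- exact: measurable_funTS.
move=> x /=; rewrite in_itv/= => /andP[x0 x1].
rewrite mulnC exprM -exprMn EFin_expe.
apply: lee_expe; last exact: indic_oo_op_ge.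
by rewrite lee_fin mulr_ge0// exprn_ge0// subr_ge0 ltW.
Qed.

Lemma integral_indic_oo_op_le (R : realType) (b : R) m p : 1 < b -> (0 < p)%N ->
  (\int[completed_lebesgue_measure]_x (indic_oo_op b m x ^+ p) <=
   (((b - 1) * m%:R) ^+ p * b ^+ (p * (m - 1)).+1 / (p * (m - 1)).+1%:R)%:E)%E.
Proof.
move=> b1 p0; have b0 : 0 < b by exact: lt_trans b1.
have A0 : 0 <= (b - 1) * m%:R by rewrite mulr_ge0// subr_ge0 ltW.
rewrite -(@integral_exp_oo R _ b (p * (m - 1)) (exprn_ge0 p A0) (ltW b0)).
have m0b : measurable (`]0%R, b[%classic : set (lebesgueR R)).
  by apply: measurable_lebesgueR; exact: measurable_itv.
have -> : (\int[completed_lebesgue_measure]_x (indic_oo_op b m x ^+ p) =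
    \int[completed_lebesgue_measure]_(x in (`]0%R, b[ : set R))
      (indic_oo_op b m x ^+ p))%E.
  rewrite [RHS]integral_mkcond; apply: eq_integral => x _; rewrite patchE.
  case: ifPn => // /negP; rewrite inE/= in_itv/= => /negP xb.
  (* Outside []0, b[] the function vanishes, and so does its [p]-th power since [p > 0]. *)
  by rewrite indic_oo_op_eq0//; case: p p0 {A0 xb} => // p _; rewrite expeS mul0e.
apply: ge0_le_integral; [exact: m0b| | | |].
- by move=> x _; rewrite expe_ge0// indic_oo_op_ge0.
- by apply: measurable_funTS; apply: measurable_fun_expe; exact: measurable_indic_oo_op.
- by apply: measurable_EFin_expB; exact: measurable_itv.
move=> x /=; rewrite in_itv/= => /andP[x0 xb].
rewrite mulnC exprM -exprMn EFin_expe.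
by apply: lee_expe; [exact: indic_oo_op_ge0|exact: indic_oo_op_le].
Qed.

(** Passage to the limit as [b] decreases to [1], by continuity of [b ^ M]. *)
Lemma le_of_le_mul_exp (R : realType) (c C : R) M :
  (forall b, 1 < b -> c <= C * b ^+ M) -> c <= C.
Proof.
move=> H.
have cvgC : (C *: 'X^M : {poly R}).[b] @[b --> 1^'+] --> (C *: 'X^M : {poly R}).[1].
  by apply: cvg_at_right_filter; exact: continuous_horner.
have -> : C = (C *: 'X^M : {poly R}).[1] by rewrite hornerZ hornerXn expr1n mulr1.
apply: (cvgr_to_ge cvgC); near=> b; rewrite hornerZ hornerXn; apply: H.
near: b; exact: nbhs_right_gt.
Unshelve. all: by end_near. Qed.

(** The lower bound at order [n] and the upper bound at order [n + k] share the factor [(b - 1)^p].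
    Once it is cancelled, only a power of [b] separates [cesaro_const] from [C]. *)
Lemma cesaro_const_optimal (R : realType) (n k p : nat) (C : R) :
  (0 < n)%N -> (0 < p)%N ->
  (forall f : R -> \bar R, Mplus f ->
     (LnormRplus p (cesaro_dual n f) ^+ p <=
      C%:E * LnormRplus p (cesaro_dual (n + k) f) ^+ p)%E) ->
  cesaro_const R n k p <= C.
Proof.
move=> n0 p0 H; have nk0 : (0 < n + k)%N by rewrite ltn_addr.
(* The first summand is the power of [b] in the upper bound, the second is that in the denominator
   of the lower bound. *)
apply: (@le_of_le_mul_exp _ _ _ ((p * (n + k - 1)).+1 + n * p)) => b b1.
have b0 : 0 < b by exact: lt_trans b1.
have b10 : 0 < b - 1 by rewrite subr_gt0.
pose N m := (\int[completed_lebesgue_measure]_x (indic_oo_op b m x ^+ p))%E.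
have HN : (N n <= C%:E * N (n + k)%N)%E.
  have := H _ (Mplus_indic_oo b).
  by rewrite !LnormRplus_cesaro_dual//; exact: Mplus_indic_oo.
have Nle : (N (n + k)%N <= _)%E := integral_indic_oo_op_le (n + k) b1 p0.
have Nnge : (_ <= N n)%E := integral_indic_oo_op_ge n p b1.
have Nge0 : (0 <= N (n + k)%N)%E.
  by apply: integral_ge0 => x _; rewrite expe_ge0// indic_oo_op_ge0.
have E m : (0 < m)%N -> p%:R * (m%:R - 1) + 1 = (p * (m - 1)).+1%:R :> R.
  by move=> m0; rewrite -natr1 natrM natrB.
rewrite /cesaro_const !E//; clear E.
set u := (p * (n - 1)).+1%:R in Nnge *; set v := (p * (n + k - 1)).+1%:R in Nle *.
have u0 : 0 < u by rewrite ltr0n.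
have v0 : 0 < v by rewrite ltr0n.
have nR : 0 < n%:R :> R by rewrite ltr0n.
have nkR : 0 < (n + k)%:R :> R by rewrite ltr0n.
(* The two bounds on [N (n + k)] make it finite, so the rest is an inequality between reals. *)
move: HN Nle Nge0; case: (N (n + k)%N) => [r|//|//] HN; rewrite !lee_fin => rU r0.
have := le_trans Nnge HN; rewrite -EFinM lee_fin => LCr.
have L0 : 0 < ((b - 1) * n%:R / b ^+ n) ^+ p / u.
  by rewrite divr_gt0// exprn_gt0// divr_gt0 ?exprn_gt0// mulr_gt0.
(* A negative [C] would make [C * r] non-positive, although it dominates a positive number. The sign
   is needed to multiply the upper bound on [r] by [C]. *)
have C0 : 0 <= C.
  rewrite leNgt; apply/negP => C0; have := lt_le_trans L0 LCr.
  by rewrite ltNge mulr_le0_ge0// ltW.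
have := le_trans LCr (ler_wpM2l C0 rU).
rewrite !exprMn exprVn -exprM exprD.
set B := b ^+ (n * p); set B' := b ^+ (p * (n + k - 1)).+1.
have B0 : 0 < B by rewrite exprn_gt0.
set e := (b - 1) ^+ p; have e0 : 0 < e by rewrite exprn_gt0.
set y := n%:R ^+ p; set z := (n + k)%:R ^+ p.
have z0 : 0 < z by rewrite exprn_gt0.
move=> LCU.
(* Both sides are written as the corresponding side of [LCU] times the same positive factor. *)
have -> : y / z * (v / u) = (e * y / B / u) * (v * B / (e * z)).
  by field; rewrite !gt_eqF.
have -> : C * (B' * B) = C * (e * z * B' / v) * (v * B / (e * z)).
  by field; rewrite !gt_eqF.
by rewrite ler_pM2r// divr_gt0// mulr_gt0.
Qed.

Unset Implicit Arguments.

Theorem theorem2p3 (R : realType) (n k p : nat)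
    (hn : (1 <= n)%N) (hk : (1 <= k)%N) (hp : p = 1%N \/ p = 2%N) :
  (forall f : R -> \bar R, Mplus f ->
     (LnormRplus p (cesaro_dual n f) ^+ p <=
      (cesaro_const R n k p)%:E *
      LnormRplus p (cesaro_dual (n + k) f) ^+ p)%E)
  /\
  (forall C : R,
     (forall f : R -> \bar R, Mplus f ->
        (LnormRplus p (cesaro_dual n f) ^+ p <=
         C%:E * LnormRplus p (cesaro_dual (n + k) f) ^+ p)%E) ->
     cesaro_const R n k p <= C).
Proof.
split; last first.
  move=> C; apply: cesaro_const_optimal; first exact: hn.
  by case: hp => ->.
move=> f Mf; case: hp => ->; last exact: LnormRplus2_cesaro_dual_le.
(* For [p = 1] the constant is [1] and both sides equal the integral of [f]. *)
rewrite cesaro_const1// mul1e !LnormRplus1_cesaro_dual//.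
by rewrite (leq_trans hn)// leq_addr.
Qed.
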